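(* There is an isomorphism of categories between $\mathbf{QAb}$ and $\mathbf{QAb}^i$.
   Context: A quasi-order is a reflexive and transitive relation. An abelian qo-group $(G,\preceq)$ is an abelian group $G$ (written additively) with a translation-invariant quasi-order $\preceq$ ($a\preceq b$ implies $a+c\preceq b+c$). $\mathbf{QAb}$ is the category of abelian qo-groups with order-preserving group homomorphisms. The positive cone of $(G,\preceq)$ is the submonoid $G_0^+=\{g\in G:0\preceq g\}$. Let $\mathbf{Mon}$ be the category of monoids. Let $C:\mathbf{QAb}\to\mathbf{Mon}$ be the functor assigning to each abelian qo-group its positive cone and to each order-preserving homomorphism its restriction to positive cones. Let $U':\mathbf{QAb}\to\mathbf{Mon}$ be the functor forgetting inverses and the quasi-order. Let $\tau:C\to U'$ be the natural transformation whose component $\tau_G:G_0^+\to U'G$ is the inclusion. $\mathbf{QAb}^i$ is the category whose objects are the components $\tau_G$, for abelian qo-groups $G$, and whose morphisms $\tau_G\to\tau_H$ are the commuting squares $(U'f,Cf)$, with $U'f\circ\tau_G=\tau_H\circ Cf$, induced by order-preserving group homomorphisms $f:G\to H$; composition is componentwise. *)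

(* Defs.v *)
From HB Require Import structures.
From mathcomp Require Import all_boot all_order all_algebra.
From mathcomp Require Import boolp.

Set Implicit Arguments.
Unset Strict Implicit.
Unset Printing Implicit Defensive.

Import GRing.Theory.
Local Open Scope ring_scope.

Record category := Category {
  object :> Type;
  hom : object -> object -> Type;
  idm : forall A, hom A A;
  compm : forall A B C, hom B C -> hom A B -> hom A C;
  compmA : forall A B C D (h : hom C D) (g : hom B C) (f : hom A B),
    compm h (compm g f) = compm (compm h g) f;
  comp1m : forall A B (f : hom A B), compm (idm B) f = f;
  compm1 : forall A B (f : hom A B), compm f (idm A) = f }.

Arguments idm {c} A.
Arguments compm {c A B C} g f.

Record functor (C D : category) := Functor {
  fobj :> C -> D;
  fmap : forall A B, hom A B -> hom (fobj A) (fobj B);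
  fmap1 : forall A, fmap (idm A) = idm (fobj A);
  fmapM : forall A B X (g : hom B X) (f : hom A B),
    fmap (compm g f) = compm (fmap g) (fmap f) }.

Arguments fmap {C D} F {A B} f : rename.

Definition functor_id (C : category) : functor C C :=
  @Functor C C id (fun A B f => f) (fun A => erefl) (fun A B X g f => erefl).

Section FunctorComp.
Variables (C D E : category) (G : functor D E) (F : functor C D).

Lemma functor_comp1 A : fmap G (fmap F (idm A)) = idm (G (F A)).
Proof. by rewrite !fmap1. Qed.

Lemma functor_compM A B X (g : hom B X) (f : hom A B) :
  fmap G (fmap F (compm g f)) = compm (fmap G (fmap F g)) (fmap G (fmap F f)).
Proof. by rewrite !fmapM. Qed.

Definition functor_comp : functor C E :=
  @Functor C E (fun A => G (F A)) (fun A B f => fmap G (fmap F f))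
    functor_comp1 functor_compM.
End FunctorComp.

(* Isomorphism, not equivalence: both composites are equal to the identity
   functors, on objects as well as on morphisms. *)
Definition isomorphic_categories (C D : category) : Prop :=
  exists (F : functor C D) (G : functor D C),
    functor_comp G F = functor_id C /\ functor_comp F G = functor_id D.

Record nat_trans (C D : category) (F G : functor C D) := NatTrans {
  component :> forall A, hom (F A) (G A);
  naturality : forall A B (f : hom A B),
    compm (fmap G f) (component A) = compm (component B) (fmap F f) }.

Record arrow (E : category) := Arrow {
  adom : E;
  acod : E;
  amor : hom adom acod }.

Record square (E : category) (a b : arrow E) := Square {
  sq_cod : hom (acod a) (acod b);
  sq_dom : hom (adom a) (adom b);
  sq_comm : compm sq_cod (amor a) = compm (amor b) sq_dom }.

Section Squares.
Variable E : category.
Implicit Types a b c d : arrow E.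

Lemma squareP a b (s t : square a b) :
  sq_cod s = sq_cod t -> sq_dom s = sq_dom t -> s = t.
Proof.
case: s t => [u v p] [u' v' q] /= eu ev; subst u' v'.
by rewrite (Prop_irrelevance p q).
Qed.

Definition square_id a : square a a.
Proof. by exists (idm (acod a)) (idm (adom a)); rewrite comp1m compm1. Defined.

Definition square_comp a b c (t : square b c) (s : square a b) : square a c.
Proof.
exists (compm (sq_cod t) (sq_cod s)) (compm (sq_dom t) (sq_dom s)).
by rewrite -compmA sq_comm compmA sq_comm compmA.
Defined.

Lemma square_compA a b c d (r : square c d) (t : square b c) (s : square a b) :
  square_comp r (square_comp t s) = square_comp (square_comp r t) s.
Proof. by apply: squareP; apply: compmA. Qed.

Lemma square_comp1m a b (s : square a b) : square_comp (square_id b) s = s.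
Proof. by apply: squareP; apply: comp1m. Qed.

Lemma square_compm1 a b (s : square a b) : square_comp s (square_id a) = s.
Proof. by apply: squareP; apply: compm1. Qed.
End Squares.

Section Components.
Variables (D E : category) (F G : functor D E) (tau : nat_trans F G).

Definition component_arrow (A : D) : arrow E := Arrow (tau A).

Definition induced_square (A B : D) (f : hom A B) :
    square (component_arrow A) (component_arrow B) :=
  @Square E (component_arrow A) (component_arrow B)
    (fmap G f) (fmap F f) (naturality tau f).

Inductive is_component : arrow E -> Prop :=
  IsComponent A : is_component (component_arrow A).

(* [is_induced] is indexed by the arrows, not by objects of [D]: a square
   between two components is induced as soon as it is induced by some morphism
   between some objects having these components. *)
Inductive is_induced : forall a b, square a b -> Prop :=
  IsInduced A B (f : hom A B) : is_induced (induced_square f).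

Lemma is_induced_id a : is_component a -> is_induced (square_id a).
Proof.
case=> A; have -> : square_id (component_arrow A) = induced_square (idm A).
  by apply: squareP; rewrite /= fmap1.
exact: IsInduced.
Qed.

(* Two induced squares can be composed as soon as an object of [D] can be
   recovered from its component. *)
Hypothesis component_inj : injective component_arrow.

Lemma is_induced_from a b (s : square a b) : is_induced s ->
  forall A (ea : a = component_arrow A), exists B (f : hom A B)
    (eb : b = component_arrow B),
  induced_square f =
    ecast x (square x (component_arrow B)) ea (ecast y (square a y) eb s).
Proof.
case=> A' B f A ea; have eA := component_inj ea; subst A'.
exists B, f, erefl; by rewrite (Prop_irrelevance ea erefl).
Qed.

Lemma is_induced_comp a b c (t : square b c) (s : square a b) :
  is_induced t -> is_induced s -> is_induced (square_comp t s).
Proof.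
move=> it is_; case: is_ t it => A B f t it.
have [X [g [ec /= gE]]] := is_induced_from it erefl.
subst c; rewrite /= in gE; rewrite -gE.
have -> : square_comp (induced_square g) (induced_square f)
          = induced_square (compm g f).
  by apply: squareP; rewrite /= fmapM.
exact: IsInduced.
Qed.

Definition comp_obj := {a : arrow E | is_component a}.

Definition comp_hom (a b : comp_obj) :=
  {s : square (sval a) (sval b) | is_induced s}.

Definition comp_id (a : comp_obj) : comp_hom a a :=
  exist _ (square_id (sval a)) (is_induced_id (svalP a)).

Definition comp_comp (a b c : comp_obj) (t : comp_hom b c) (s : comp_hom a b) :
    comp_hom a c :=
  exist _ (square_comp (sval t) (sval s)) (is_induced_comp (svalP t) (svalP s)).

Lemma comp_homP a b (s t : comp_hom a b) : sval s = sval t -> s = t.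
Proof.
case: s t => [s p] [t q] /= e; subst t.
by rewrite (Prop_irrelevance p q).
Qed.

Definition component_category : category.
Proof.
apply: (@Category comp_obj comp_hom comp_id comp_comp).
- by move=> *; apply: comp_homP; apply: square_compA.
- by move=> *; apply: comp_homP; apply: square_comp1m.
- by move=> *; apply: comp_homP; apply: square_compm1.
Defined.
End Components.

(* The quasi-order is boolean, as usual in the library; with the classical
   axioms of [boolp] this covers every relation. The choice operator carried by
   a [zmodType] is part of the data of a group, and also of a [monoidType]. *)
Record qoGroup := QoGroup {
  qo_sort :> zmodType;
  qo_le : rel qo_sort;
  qo_le_refl : reflexive qo_le;
  qo_le_trans : transitive qo_le;
  qo_leD2r : forall a b c, qo_le a b -> qo_le (a + c) (b + c) }.

Arguments qo_le {q} : rename.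

Notation "a ⪯ b" := (qo_le a b) (at level 70, no associativity) : ring_scope.

Record qoHom (G H : qoGroup) := QoHom {
  qo_fun :> {additive G -> H};
  qo_homo : {homo qo_fun : a b / a ⪯ b} }.

Section AdditiveExt.
Variables U V : baseAddUMagmaType.

Lemma additive_ext (f g : {additive U -> V}) : f =1 g -> f = g.
Proof.
case: f g => [f [[fa]]] [g [[ga]]] /= /funext efg; subst g.
by rewrite (Prop_irrelevance fa ga).
Qed.
End AdditiveExt.

Lemma qoHom_ext (G H : qoGroup) (f g : qoHom G H) : f =1 g -> f = g.
Proof.
case: f g => [f fo] [g go] /= /additive_ext efg; subst g.
by rewrite (Prop_irrelevance fo go).
Qed.

Definition qoHom_id (G : qoGroup) : qoHom G G :=
  @QoHom G G (idfun : {additive G -> G}) (fun a b le_ab => le_ab).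

Lemma qoHom_comp_homo (G H K : qoGroup) (g : qoHom H K) (f : qoHom G H) :
  {homo (g \o f) : a b / a ⪯ b}.
Proof. by move=> a b le_ab; do 2 apply: qo_homo. Qed.

Definition qoHom_comp (G H K : qoGroup) (g : qoHom H K) (f : qoHom G H) :
    qoHom G K :=
  @QoHom G K (g \o f : {additive G -> K}) (qoHom_comp_homo g f).

Definition QAb : category.
Proof.
by apply: (@Category qoGroup qoHom qoHom_id qoHom_comp) => *; apply: qoHom_ext.
Defined.

Notation monoidHom := UMagmaMorphism.type.

Lemma monoidHom_ext (M N : monoidType) (f g : monoidHom M N) : f =1 g -> f = g.
Proof.
case: f g => [f [[f1] [fM]]] [g [[g1] [gM]]] /= /funext efg; subst g.
by rewrite (Prop_irrelevance f1 g1) (Prop_irrelevance fM gM).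
Qed.

Definition Mon : category.
Proof.
by apply: (@Category monoidType (fun M N => monoidHom M N)
  (fun M => idfun : monoidHom M M)
  (fun M N P g f => g \o f : monoidHom M P)) => *; apply: monoidHom_ext.
Defined.

(* [to_multiplicative] is the additive monoid of a group, seen in the
   multiplicative hierarchy, where the library has general monoids. *)
Definition forget_inverses : functor QAb Mon.
Proof.
apply: (@Functor QAb Mon (fun G : qoGroup => Algebra.to_multiplicative G : monoidType)
  (fun G H (f : qoHom G H) =>
     Algebra.to_fmultiplicative f :
       monoidHom (Algebra.to_multiplicative G) (Algebra.to_multiplicative H)))
  => *; exact: monoidHom_ext.
Defined.

Definition nonneg (G : qoGroup) : pred (Algebra.to_multiplicative G) :=
  fun g => (0 : G) ⪯ g.

Lemma nonneg_monoid_closed (G : qoGroup) : monoid_closed (@nonneg G).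
Proof.
split=> [|a b a_ge0 b_ge0]; first exact: qo_le_refl.
apply: (@qo_le_trans G _ _ _ b_ge0).
by have := @qo_leD2r G _ _ b a_ge0; rewrite add0r.
Qed.

Definition cone (G : qoGroup) := {g : Algebra.to_multiplicative G | nonneg g}.

HB.instance Definition _ (G : qoGroup) := SubChoice.on (cone G).
HB.instance Definition _ (G : qoGroup) :=
  SubChoice_isSubMonoid.Build (Algebra.to_multiplicative G) (@nonneg G) (cone G)
    (nonneg_monoid_closed G).

Section ConeMap.
Variables (G H : qoGroup) (f : qoHom G H).

Lemma nonneg_map (x : cone G) : nonneg (f (val x) : Algebra.to_multiplicative H).
Proof. by have := qo_homo f (valP x); rewrite raddf0. Qed.

Definition cone_map (x : cone G) : cone H := Sub (f (val x)) (nonneg_map x).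

Lemma cone_map_monoid_morphism : monoid.monoid_morphism cone_map.
Proof.
split=> [|x y]; apply: val_inj; rewrite /= ?raddf0 //.
exact: raddfD.
Qed.

HB.instance Definition _ :=
  isUMagmaMorphism.Build (cone G) (cone H) cone_map cone_map_monoid_morphism.
End ConeMap.

Definition positive_cone : functor QAb Mon.
Proof.
apply: (@Functor QAb Mon (fun G : qoGroup => cone G : monoidType)
  (fun G H (f : qoHom G H) => cone_map f : monoidHom (cone G) (cone H)))
  => *; apply: monoidHom_ext => x; exact: val_inj.
Defined.

Definition cone_inclusion : nat_trans positive_cone forget_inverses.
Proof.
apply: (@NatTrans QAb Mon positive_cone forget_inverses
  (fun G : qoGroup => (val : cone G -> Algebra.to_multiplicative G)
                      : monoidHom (cone G) (Algebra.to_multiplicative G)))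
  => *; exact: monoidHom_ext.
Defined.

(* For [QAb^i] to be closed under composition, an abelian qo-group must be
   determined by the inclusion of its positive cone: the codomain gives back the
   group, and the image gives back the quasi-order. *)
Definition group_data := {T : Type &
  (hasChoice T * hasDecEq T * (T -> T -> T) * T * pred T)%type}.

Definition arrow_data (a : arrow Mon) : group_data :=
  let M : monoidType := acod a in
  existT _ (M : Type) (Choice.choice_hasChoice_mixin (Choice.class M),
     Choice.eqtype_hasDecEq_mixin (Choice.class M), @monoid.mul M, @monoid.one M,
     fun x => `[< exists y, (amor a : monoidHom _ _) y = x >]).

Definition qoGroup_data (G : qoGroup) : group_data :=
  existT _ (G : Type) (Choice.choice_hasChoice_mixin (Choice.class G),
     Choice.eqtype_hasDecEq_mixin (Choice.class G), @GRing.add G, @GRing.zero G,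
     fun x : G => 0 ⪯ x).

Lemma arrow_data_component (G : qoGroup) :
  arrow_data (component_arrow cone_inclusion G) = qoGroup_data G.
Proof.
rewrite /arrow_data /qoGroup_data /=; do 2 f_equal.
apply/funext => x; apply/asboolP/idP => [[y <-]|x_ge0]; first exact: (valP y).
by exists (exist _ x x_ge0).
Qed.

Lemma qo_le_subr (G : qoGroup) (a b : G) : (a ⪯ b) = (0 ⪯ b - a).
Proof.
apply/idP/idP => [/(qo_leD2r (- a))|/(qo_leD2r a)]; first by rewrite subrr.
by rewrite add0r subrK.
Qed.

Lemma existT_inj (P : Type -> Type) T (x y : P T) :
  existT P T x = existT P T y -> x = y.
Proof.
by move=> e; have := projT2_eq e; rewrite (Prop_irrelevance (projT1_eq e) erefl).
Qed.

Lemma qoGroup_data_inj : injective qoGroup_data.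
Proof.
move=> [[T c] le le_refl le_trans leD] [[T' c'] le' le_refl' le_trans' leD'].
move=> e; have eT : T = T' := projT1_eq e; subst T'.
have {e} := existT_inj e.
case: c le le_refl le_trans leD => ch dq [op] [z] [ad] [zm] [um] [cm] [sm].
case: c' le' le_refl' le_trans' leD' => ch' dq' [op'] [z'] [ad'] [zm'] [um'] [cm'] [sm'].
move=> le' le_refl' le_trans' leD' le le_refl le_trans leD [].
rewrite /GRing.zero /GRing.add /Algebra.add /Algebra.zero /=.
move=> ech edq ead ez ele; have {}ead : ad = ad' := ead.
subst ch' dq' ad' z'.
have eum := Prop_irrelevance um um'; have ecm := Prop_irrelevance cm cm'.
subst um' cm'; have esm := Prop_irrelevance sm sm'; subst sm'.
have eop : op = op'.
  have addE x : op x = ad (op' x) (ad x (op x)).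
    by rewrite [RHS]sm [X in _ = ad X _]zm' [RHS]um.
  apply/funext => x; rewrite addE [ad x _]cm [X in ad _ X]zm.
  by rewrite [LHS]cm [LHS]um.
subst op'; have ezm := Prop_irrelevance zm zm'; subst zm'.
have ele' : le = le'.
  pose G := QoGroup le_refl le_trans leD.
  pose G' := QoGroup le_refl' le_trans' leD'.
  apply/funext => a; apply/funext => b.
  apply: etrans (@qo_le_subr G a b) _; apply/esym.
  apply: etrans (@qo_le_subr G' a b) _; apply/esym.
  exact: (congr1 (@^~ _) ele).
subst le'; congr QoGroup; exact: Prop_irrelevance.
Qed.

Lemma component_arrow_inj : injective (component_arrow cone_inclusion).
Proof.
move=> G H /(congr1 arrow_data); rewrite !arrow_data_component.
exact: qoGroup_data_inj.
Qed.

Definition QAbi : category := component_category component_arrow_inj.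

(* Main.v *)
From mathcomp Require Import all_boot.
From mathcomp Require Import boolp.
Require Import Defs.

Set Implicit Arguments.
Unset Strict Implicit.
Unset Printing Implicit Defensive.

(** The isomorphism sends a group to the inclusion of its positive cone and a
homomorphism to the square it induces. More generally, for a natural
transformation [tau] from [F] to [G], the functor that sends an object to its
component and a morphism to its induced square is an isomorphism onto the
category of components as soon as two things hold: an object is determined by
its component, and [G] is faithful. The first makes the functor injective on
objects; the second makes it injective on morphisms, since the codomain part of
the square induced by [f] is [fmap G f]; surjectivity is the definition of the
category of components. For the inclusion of positive cones, the first condition
is [component_arrow_inj]: the codomain of the inclusion gives back the group and
its image the quasi-order, since [a ⪯ b] means that [b - a] is in the cone.
Forgetting inverses and the quasi-order is faithful because a homomorphism is
determined by its underlying function.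

An isomorphism of categories is a strict notion, so equalities between
morphisms with provably equal but different ends have to be handled. This is
done with [arrow]: morphisms with different ends become elements of one type
when packed with their ends, and no transport along equalities of objects is
needed in the statements. [bijective_on_arrows_iso] is the criterion in this
language: a functor that is bijective on packed arrows is an isomorphism of
categories. Bijectivity on objects follows, as objects can be recovered from
their identities. *)

Section Arrows.
Variable E : category.

(** The only place where a transport along an equality of objects occurs; it is
removed because such equalities are proof-irrelevant. *)
Lemma Arrow_inj (A B : E) : injective (@Arrow E A B).
Proof.
move=> f g efg.
pose cast_to x (eA : adom x = A) (eB : acod x = B) : hom A B :=
  ecast Z (hom A Z) eB (ecast Z (hom Z (acod x)) eA (amor x)).
have cast_eq x : Arrow f = x -> forall eA eB, f = cast_to x eA eB.
  move=> <- eA eB; rewrite /cast_to.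
  by rewrite (Prop_irrelevance eA erefl) (Prop_irrelevance eB erefl).
exact: (cast_eq (Arrow g) efg erefl erefl).
Qed.

Lemma Arrow_idm (A B : E) : A = B -> Arrow (idm A) = Arrow (idm B).
Proof. by move=> ->. Qed.

Lemma Arrow_compm (A B C A' B' C' : E) (g : hom B C) (f : hom A B)
    (g' : hom B' C') (f' : hom A' B') :
  Arrow g = Arrow g' -> Arrow f = Arrow f' ->
  Arrow (compm g f) = Arrow (compm g' f').
Proof.
move=> eg ef.
have eA : A = A' := congr1 (@adom E) ef.
have eB : B = B' := congr1 (@acod E) ef.
have eC : C = C' := congr1 (@acod E) eg.
by subst A' B' C'; rewrite (Arrow_inj eg) (Arrow_inj ef).
Qed.
End Arrows.

Definition map_arrow (C D : category) (F : functor C D) (x : arrow C) : arrow D :=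
  Arrow (fmap F (amor x)).

(** Two functors that agree on packed arrows agree on objects because they agree
on identities. *)
Lemma functor_ext (C D : category) (F G : functor C D) :
  map_arrow F =1 map_arrow G -> F = G.
Proof.
move=> eFG.
have eob : fobj F = fobj G.
  by apply/funext => A; exact: (congr1 (@adom D) (eFG (Arrow (idm A)))).
case: F G eFG eob => [F Fm F1 FM] [G Gm G1 GM] /= eFG eob; subst G.
have em : Fm = Gm.
  apply: functional_extensionality_dep => A.
  apply: functional_extensionality_dep => B.
  by apply/funext => f; apply: Arrow_inj; exact: (eFG (Arrow f)).
subst Gm.
by rewrite (Prop_irrelevance F1 G1) (Prop_irrelevance FM GM).
Qed.

Section BijectiveOnArrows.
Variables (C D : category) (F : functor C D).
Hypothesis F_inj : injective (map_arrow F).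
Hypothesis F_surj : forall y, exists x, map_arrow F x = y.

Lemma fobj_inj : injective F.
Proof.
move=> A B eAB.
suff /(congr1 (@adom C)) : Arrow (idm A) = Arrow (idm B) by [].
by apply: F_inj; rewrite /map_arrow /= !fmap1; exact: Arrow_idm.
Qed.

Lemma fobj_surj a : exists A, F A = a.
Proof.
by have [x /(congr1 (@adom D)) ex] := F_surj (Arrow (idm a)); exists (adom x).
Qed.

Definition inv_obj a : C := sval (cid (fobj_surj a)).

Lemma inv_objK a : F (inv_obj a) = a.
Proof. exact: svalP (cid (fobj_surj a)). Qed.

(** An arrow over [s] has the chosen ends, since [F] is injective on objects. *)
Lemma fmap_surj a b (s : hom a b) :
  exists f : hom (inv_obj a) (inv_obj b), Arrow (fmap F f) = Arrow s.
Proof.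
have [[A B f] ef] := F_surj (Arrow s).
have eA : A = inv_obj a.
  by apply: fobj_inj; rewrite inv_objK; exact: (congr1 (@adom D) ef).
have eB : B = inv_obj b.
  by apply: fobj_inj; rewrite inv_objK; exact: (congr1 (@acod D) ef).
by subst A B; exists f.
Qed.

Definition inv_map a b (s : hom a b) : hom (inv_obj a) (inv_obj b) :=
  sval (cid (fmap_surj s)).

Lemma inv_mapK a b (s : hom a b) : Arrow (fmap F (inv_map s)) = Arrow s.
Proof. exact: svalP (cid (fmap_surj s)). Qed.

Lemma fmap_inj A B (f g : hom A B) : Arrow (fmap F f) = Arrow (fmap F g) -> f = g.
Proof. by move=> efg; apply/Arrow_inj/F_inj. Qed.

Lemma inv_map1 a : inv_map (idm a) = idm (inv_obj a).
Proof.
apply: fmap_inj; rewrite inv_mapK fmap1.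
by apply: Arrow_idm; rewrite inv_objK.
Qed.

Lemma inv_mapM a b c (t : hom b c) (s : hom a b) :
  inv_map (compm t s) = compm (inv_map t) (inv_map s).
Proof.
apply: fmap_inj; rewrite inv_mapK fmapM.
by apply: Arrow_compm; rewrite inv_mapK.
Qed.

Definition inv_functor : functor D C := Functor inv_map1 inv_mapM.

Lemma bijective_on_arrows_iso : isomorphic_categories C D.
Proof.
exists F, inv_functor; split; apply: functor_ext => [[A B f]].
- by apply: F_inj; exact: (inv_mapK (fmap F f)).
- exact: inv_mapK.
Qed.
End BijectiveOnArrows.

Section ComponentFunctor.
Variables (D E : category) (F G : functor D E) (tau : nat_trans F G).
Hypothesis component_inj : injective (component_arrow tau).
Hypothesis G_faithful : forall A B (f g : hom A B), fmap G f = fmap G g -> f = g.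

Let K := component_category component_inj.

Definition component_obj (A : D) : K :=
  exist (@is_component _ _ _ _ tau) (component_arrow tau A) (IsComponent tau A).

Definition component_map (A B : D) (f : hom A B) :
    hom (component_obj A) (component_obj B) :=
  exist (fun s => is_induced tau s) (induced_square tau f) (IsInduced tau f).

Lemma component_map1 A : component_map (idm A) = idm (component_obj A).
Proof. by apply: comp_homP; apply: squareP; rewrite /= fmap1. Qed.

Lemma component_mapM A B X (g : hom B X) (f : hom A B) :
  component_map (compm g f) = compm (component_map g) (component_map f).
Proof. by apply: comp_homP; apply: squareP; rewrite /= fmapM. Qed.

Definition component_functor : functor D K :=
  Functor component_map1 component_mapM.

Lemma component_functor_inj : injective (map_arrow component_functor).
Proof.
move=> [A B f] [A' B' f'] e.
have eA : A = A'.
  by apply: component_inj; exact: (congr1 (fun x => sval (@adom K x)) e).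
have eB : B = B'.
  by apply: component_inj; exact: (congr1 (fun x => sval (@acod K x)) e).
subst A' B'; congr Arrow; apply: G_faithful.
exact: (congr1 (fun s => sq_cod (sval s)) (Arrow_inj e)).
Qed.

Lemma component_functor_surj y : exists x, map_arrow component_functor x = y.
Proof.
case: y => [[a ia] [b ib] [/= s is_ind]].
case: is_ind ia ib => A B f ia ib; exists (Arrow f).
by rewrite (Prop_irrelevance ia (IsComponent tau A))
           (Prop_irrelevance ib (IsComponent tau B)).
Qed.

Lemma component_category_iso : isomorphic_categories D K.
Proof.
exact: bijective_on_arrows_iso component_functor_inj component_functor_surj.
Qed.
End ComponentFunctor.

Lemma forget_inverses_faithful (G H : QAb) (f g : hom G H) :
  fmap forget_inverses f = fmap forget_inverses g -> f = g.
Proof.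
move=> efg; apply: qoHom_ext => x.
by have := congr1 (fun h : @hom Mon (forget_inverses G) (forget_inverses H) =>
  (h : monoidHom _ _) x) efg.
Qed.

Theorem theorem2p11 : isomorphic_categories QAb QAbi.
Proof.
exact: component_category_iso component_arrow_inj forget_inverses_faithful.
Qed.
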